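(* Let $B:\mathbb{R}^{\hat n}\to\mathbb{R}^{\hat m}$ and $G:\mathbb{R}^{\hat n}\to\mathbb{R}^{\hat l}$ be twice continuously differentiable, let $D\subseteq\mathbb{R}^{\hat l}$ be a polyhedral set (finite union of convex polyhedral sets), $\Gamma:=\{z\mid G(z)\in D\}$ and $\Omega:=\{B(z)\mid z\in\Gamma\}$. Let $\bar\omega\in\Omega$ and $\bar z\in\Sigma_{\bar\omega}$ be such that $\nabla B(\bar z)w=0$, $w\in L_{\bar z}$ imply $w=0$. Consider $\gamma_B>0$ and an open neighborhood $\widetilde W$ of $\bar z$ such that $$\min\{\|\nabla B(\bar z)w\|\mid w\in L_{\bar z},\|w\|=1\}>\gamma_B,$$ $$\|\nabla B(z)w\|\ge\gamma_B\|w\|\ \ \forall z\in\Gamma\cap\widetilde W,\ w\in L_z,\qquad \|B(z_1)-B(z_2)\|\ge\gamma_B\|z_1-z_2\|\ \ \forall z_1,z_2\in\Gamma\cap\widetilde W.$$ Consider open neighborhoods $\mathcal O$ of $\bar\omega$ and $W\subseteq\widetilde W$ of $\bar z$ and a bijective mapping $\hat z:\Omega\cap\mathcal O\to\Gamma\cap W$ which is Lipschitzian on $\Omega\cap\mathcal O$ with constant $1/\gamma_B$ and satisfies $\big(B^{-1}(\omega)\cap\Gamma\big)\cap W=\{\hat z(\omega)\}$ for all $\omega\in\Omega\cap\mathcal O$. Then for all $\omega\in\Omega\cap\mathcal O$: (i) There holds $$T_\Omega(\omega)=\{\nabla B(\hat z(\omega))w\mid w\in T_\Gamma(\hat z(\omega))\}.$$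 For all $\eta\in T_\Omega(\omega)$ and for all sequences $t_k\downarrow0$ and $\eta_k\to\eta$ with $\omega+t_k\eta_k\in\Omega$, the limit $$\hat z'(\omega;\eta):=\lim_{k\to\infty}\frac{\hat z(\omega+t_k\eta_k)-\hat z(\omega)}{t_k}$$ exists and equals $\hat w_{\hat z(\omega)}(\eta,0)\in T_\Gamma(\hat z(\omega))$. (ii) Let $\eta\in T_\Omega(\omega)$ and $w:=\hat z'(\omega;\eta)$. Then $$T^2_\Omega(\omega;\eta)=\{\nabla B(\hat z(\omega))v+\nabla^2B(\hat z(\omega))(w,w)\mid v\in T^2_\Gamma(\hat z(\omega);w)\}.$$ Further, for all $\xi\in T^2_\Omega(\omega;\eta)$ and all sequences $t_k\downarrow0$ and $\xi_k\to\xi$ with $\omega+t_k\eta+\frac12t_k^2\xi_k\in\Omega$, the limit $$\hat z''(\omega;\eta,\xi):=\lim_{k\to\infty}\frac{\hat z(\omega+t_k\eta+\frac12t_k^2\xi_k)-\hat z(\omega)-t_k\hat z'(\omega;\eta)}{\frac12t_k^2}$$ exists and equals $\hat w_{\hat z(\omega)}\big(\xi-\nabla^2B(\hat z(\omega))(w,w),-\nabla^2G(\hat z(\omega))(w,w)\big)\in T^2_\Gamma\big(\hat z(\omega);\hat z'(\omega;\eta)\big)$.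
   Context: For a closed set $C$ and $z\in C$: $T_C(z)=\{u\mid\exists t_k\downarrow0,u_k\to u: z+t_ku_k\in C\}$; for $u\in T_C(z)$, $T_C^2(z;u)=\{w\mid\exists t_k\downarrow0,w_k\to w: z+t_ku+\frac12t_k^2w_k\in C\}$ (same definitions used for $\Omega$). For a set $C$, $C^+:=\mathrm{span}(C-C)$. For $z\in\Gamma$, $L_z:=\{w\mid\nabla G(z)w\in(T_D(G(z)))^+\}$ (a linear subspace). A minimum over the empty set is $+\infty$. $\Sigma_{\bar\omega}:=\{z\mid\text{for every sequence }\omega^k\to\bar\omega\text{ with }\omega^k\in\Omega\text{ there exist }z^k\to z\text{ with }z^k\in B^{-1}(\omega^k)\cap\Gamma\}$. For $z\in\Gamma$ let $\psi_z(w):=\{(\nabla B(z)w,\nabla G(z)w)\}-\big(\{0\}\times(T_D(G(z)))^+\big)$, a set-valued mapping from $\mathbb{R}^{\hat n}$ to $\mathbb{R}^{\hat m}\times\mathbb{R}^{\hat l}$, with $\mathrm{Range}\,\psi_z=\bigcup_w\psi_z(w)$ (a linear subspace). For $z\in\Gamma\cap\widetilde W$ (under the stated properties of $\gamma_B$, $\widetilde W$), $\psi_z^{-1}(\eta,q)$ is a singleton for each $(\eta,q)\in\mathrm{Range}\,\psi_z$, and $\hat w_z:\mathrm{Range}\,\psi_z\to\mathbb{R}^{\hat n}$ denotes the linear mapping with $\psi_z^{-1}(\eta,q)=\{\hat w_z(\eta,q)\}$; i.e. $\hat w_z(\eta,q)$ is the unique $w$ with $\nabla B(z)w=\eta$ and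 $\nabla G(z)w-q\in(T_D(G(z)))^+$. $\nabla^2B(z)(w,w)$ is the vector with components $w^T\nabla^2B_i(z)w$, and similarly for $G$. The values $\hat z(\omega+t_k\eta_k)$ etc. are defined for all large $k$. *)

(* Defs.v *)
From mathcomp Require Import all_boot all_order all_algebra.
From mathcomp Require Import all_classical all_reals all_analysis.
Import Order.TTheory GRing.Theory Num.Theory.
Import numFieldNormedType.Exports.

Set Implicit Arguments.
Unset Strict Implicit.
Unset Printing Implicit Defensive.

Local Open Scope classical_set_scope.
Local Open Scope ring_scope.

(* Points of R^n are row vectors. The library's norm on matrices is the sup
   norm, which induces the usual topology; quantitative bounds use [enorm]. *)

Section Vectors.
Context {R : realType}.

Definition enorm n (x : 'rV[R]_n) : R := Num.sqrt (\sum_i x 0 i ^+ 2).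

Definition convex_polyhedral n (C : set 'rV[R]_n) : Prop :=
  exists (p : nat) (A : 'M[R]_(n, p)) (b : 'rV[R]_p),
    C = [set x | forall j, (x *m A) 0 j <= b 0 j].

Definition polyhedral n (D : set 'rV[R]_n) : Prop :=
  exists (N : nat) (C : 'I_N -> set 'rV[R]_n),
    (forall i, convex_polyhedral (C i)) /\ D = \bigcup_i C i.

Definition lin_span n (S : set 'rV[R]_n) : set 'rV[R]_n :=
  [set v | exists s : seq 'rV[R]_n, {in s, forall x, S x} /\ v \in span s].

(* C^+ = span (C - C) *)
Definition splus n (C : set 'rV[R]_n) : set 'rV[R]_n :=
  lin_span [set x - y | x in C & y in C].

End Vectors.

Section Smoothness.
Context {R : realType} {n m : nat}.

Definition twice_continuously_differentiable (F : 'rV[R]_n -> 'rV[R]_m) : Prop :=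
  (forall x, differentiable F x) /\
  forall u : 'rV[R]_n, (forall x, differentiable ('D_u F) x) /\
    forall v : 'rV[R]_n, continuous ('D_v ('D_u F)).

Definition hessian (f : 'rV[R]_n -> R) (z : 'rV[R]_n) : 'M[R]_n :=
  \matrix_(j, k) 'D_(delta_mx 0 j) ('D_(delta_mx 0 k) f) z.

(* the vector with components w^T (Hessian of F_i at z) w *)
Definition hess2 (F : 'rV[R]_n -> 'rV[R]_m) (z w : 'rV[R]_n) : 'rV[R]_m :=
  \row_i (w *m hessian (fun x => F x 0 i) z *m w^T) 0 0.

End Smoothness.

Section Tangents.
Context {R : realType}.

Definition down_to_0 (t : nat -> R) : Prop :=
  (forall k, 0 < t k) /\ t @ \oo --> (0 : R).

Definition tangent n (C : set 'rV[R]_n) (z : 'rV[R]_n) : set 'rV[R]_n :=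
  [set u | exists (t : nat -> R) (u_ : nat -> 'rV[R]_n),
     [/\ down_to_0 t, u_ @ \oo --> u & forall k, C (z + t k *: u_ k)]].

Definition tangent2 n (C : set 'rV[R]_n) (z u : 'rV[R]_n) : set 'rV[R]_n :=
  [set w | exists (t : nat -> R) (w_ : nat -> 'rV[R]_n),
     [/\ down_to_0 t, w_ @ \oo --> w &
         forall k, C (z + t k *: u + (2^-1 * t k ^+ 2) *: w_ k)]].

Context {m n : nat}.

(* l is the limit of every sequence of difference quotients of f at omega
   along points of S in direction eta *)
Definition is_dirder (S : set 'rV[R]_m) (f : 'rV[R]_m -> 'rV[R]_n)
    (omega eta : 'rV[R]_m) (l : 'rV[R]_n) : Prop :=
  forall (t : nat -> R) (eta_ : nat -> 'rV[R]_m),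
    down_to_0 t -> eta_ @ \oo --> eta ->
    (forall k, S (omega + t k *: eta_ k)) ->
    (fun k => (t k)^-1 *: (f (omega + t k *: eta_ k) - f omega)) @ \oo --> l.

Definition dirder (S : set 'rV[R]_m) (f : 'rV[R]_m -> 'rV[R]_n)
    (omega eta : 'rV[R]_m) : 'rV[R]_n :=
  get [set l | is_dirder S f omega eta l].

Definition is_dirder2 (S : set 'rV[R]_m) (f : 'rV[R]_m -> 'rV[R]_n)
    (omega eta xi : 'rV[R]_m) (l : 'rV[R]_n) : Prop :=
  forall (t : nat -> R) (xi_ : nat -> 'rV[R]_m),
    down_to_0 t -> xi_ @ \oo --> xi ->
    (forall k, S (omega + t k *: eta + (2^-1 * t k ^+ 2) *: xi_ k)) ->
    (fun k => (2^-1 * t k ^+ 2)^-1 *: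
       (f (omega + t k *: eta + (2^-1 * t k ^+ 2) *: xi_ k) - f omega
        - t k *: dirder S f omega eta)) @ \oo --> l.

Definition dirder2 (S : set 'rV[R]_m) (f : 'rV[R]_m -> 'rV[R]_n)
    (omega eta xi : 'rV[R]_m) : 'rV[R]_n :=
  get [set l | is_dirder2 S f omega eta xi l].

End Tangents.

Section Setting.
Context {R : realType} {n m l : nat}.
Variables (B : 'rV[R]_n -> 'rV[R]_m) (G : 'rV[R]_n -> 'rV[R]_l).
Variable D : set 'rV[R]_l.

Definition Gamma : set 'rV[R]_n := [set z | D (G z)].

Definition Omega : set 'rV[R]_m := B @` Gamma.

Definition Llin (z : 'rV[R]_n) : set 'rV[R]_n :=
  [set w | splus (tangent D (G z)) ('d G z w)].

Definition Sigma (omegabar : 'rV[R]_m) : set 'rV[R]_n :=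
  [set z | forall omega_ : nat -> 'rV[R]_m,
     omega_ @ \oo --> omegabar -> (forall k, Omega (omega_ k)) ->
     exists z_ : nat -> 'rV[R]_n, z_ @ \oo --> z /\
       forall k, (B @^-1` [set omega_ k] `&` Gamma) (z_ k)].

Definition psi (z w : 'rV[R]_n) : set ('rV[R]_m * 'rV[R]_l) :=
  [set ('d B z w, 'd G z w) - d
     | d in [set (0 : 'rV[R]_m)] `*` splus (tangent D (G z))].

Definition psi_inv (z : 'rV[R]_n) (p : 'rV[R]_m * 'rV[R]_l) : set 'rV[R]_n :=
  [set w | psi z w p].

(* meaningful only where [psi_inv z p] is a singleton *)
Definition what (z : 'rV[R]_n) (p : 'rV[R]_m * 'rV[R]_l) : 'rV[R]_n :=
  get (psi_inv z p).

End Setting.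

(* Main.v *)
(* The polyhedral set [D] coincides near [G z] with [G z + T_D(G z)], so that for
   points [z + t w_k] of [Gamma] the quotients [(G (z + t w_k) - G z) / t] lie
   exactly in the subspace [T_D(G z)^+]. Expanding [B] and [G] (to first order
   for (i), to second order around [z + t w] for (ii)) shows that the difference
   quotients of [zhat] solve a perturbation of the system defining [what], whose
   right-hand sides converge. The linear map of that system is injective on a
   finite-dimensional space, hence has a continuous left inverse, and the
   quotients converge to [what]; no subsequence has to be extracted. *)
Require Import Defs.
From mathcomp Require Import all_boot all_order all_algebra.
From mathcomp Require Import all_classical all_reals all_analysis.
From mathcomp Require Import ring lra.
Import Order.TTheory GRing.Theory Num.Theory.
Import numFieldNormedType.Exports.
Local Open Scope classical_set_scope.
Local Open Scope ring_scope.

Set Implicit Arguments.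
Unset Strict Implicit.
Unset Printing Implicit Defensive.

(** * Comparison of the sup and Euclidean norms, and coordinatewise limits *)

Section RowVectors.
Context {R : realType}.

Lemma rV_norm_le n (x : 'rV[R]_n) (e : R) :
  0 <= e -> (forall i, `|x 0 i| <= e) -> `|x| <= e.
Proof.
move=> e0 xe; rewrite [`|x|]mx_normrE; apply: bigmax_le => // -[i j] _ /=.
by rewrite (ord1 i).
Qed.

Lemma coord_le_norm n (x : 'rV[R]_n) i : `|x 0 i| <= `|x|.
Proof. by rewrite [leRHS]mx_normrE; apply: (le_bigmax _ _ (0, i)). Qed.

Lemma norm_le_enorm n (x : 'rV[R]_n) : `|x| <= enorm x.
Proof.
apply: rV_norm_le => [|i]; first exact: sqrtr_ge0.
rewrite -sqrtr_sqr ler_wsqrtr// (bigD1 i)//= lerDl.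
by apply: sumr_ge0 => j _; exact: sqr_ge0.
Qed.

Lemma enorm_le_norm n (x : 'rV[R]_n) : enorm x <= Num.sqrt n%:R * `|x|.
Proof.
rewrite -[X in _ * X]normr_id -sqrtr_sqr -sqrtrM ?ler0n// ler_wsqrtr//.
rewrite -[X in X%:R]card_ord -sum1_card natr_sum mulr_suml.
apply: ler_sum => i _; rewrite mul1r -[leLHS]real_normK ?num_real//.
by rewrite ler_sqr ?nnegrE//; exact: coord_le_norm.
Qed.

Lemma enorm0 n : enorm (0 : 'rV[R]_n) = 0.
Proof. by apply/le_anti; rewrite sqrtr_ge0 (le_trans (enorm_le_norm _))// normr0 mulr0. Qed.

Lemma cvg_rV (T : Type) (F : set_system T) {FF : Filter F} n
    (u : T -> 'rV[R]_n) (l : 'rV[R]_n) :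
  (forall i, u x 0 i @[x --> F] --> l 0 i) -> u x @[x --> F] --> l.
Proof.
move=> ul; apply/cvgrPdist_le => e e0.
have : \forall x \near F, forall i, `|l 0 i - u x 0 i| <= e.
  by apply: filter_forall => i; move/cvgrPdist_le: (ul i); exact.
apply: filterS => x xe; apply: rV_norm_le => [|i]; first exact: ltW.
by rewrite !mxE.
Qed.

Lemma cvg_sum_real (T : Type) (F : set_system T) {FF : Filter F} (I : finType)
    (f : I -> T -> R) (a : I -> R) :
  (forall i, f i x @[x --> F] --> a i) ->
  (\sum_i f i x) @[x --> F] --> \sum_i a i.
Proof. by move=> fa; apply: cvg_big => [|i _]; [exact: add_continuous|exact: fa]. Qed.

Lemma mulmxr_continuous n m (N : 'M[R]_(n, m)) :
  continuous (fun v : 'rV[R]_n => v *m N).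
Proof.
move=> v; apply: (cvg_rV (F := nbhs v)) => j; rewrite mxE.
under eq_fun do rewrite mxE.
apply: (cvg_sum_real (F := nbhs v)) => i; apply: cvgM; last exact: cvg_cst.
exact: coord_continuous.
Qed.

Lemma quadratic_continuous n (H : 'M[R]_n) :
  continuous (fun v : 'rV[R]_n => (v *m H *m v^T) 0 0).
Proof.
move=> v; rewrite /continuous_at mxE; under eq_fun do rewrite mxE.
apply: (cvg_sum_real (F := nbhs v)) => i; rewrite [X in _ * X]mxE.
under eq_fun do rewrite [X in _ * X]mxE.
apply: cvgM; last exact: coord_continuous.
apply: (cvg_comp (fun x : 'rV[R]_n => x *m H) (fun M => M 0 i)).
  exact: mulmxr_continuous.
exact: coord_continuous.
Qed.

End RowVectors.

(** * Linear spans as kernels, and polyhedral sets near a point *)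

Section Polyhedral.
Context {R : realType}.

(** Among finite lists drawn from [S], one has a span of largest dimension. Appending another list
    cannot enlarge it, so this single span is all of [lin_span S], and [K] is the matrix of the
    identity minus the projection onto it. Membership thus becomes a linear equation, which is
    stable under limits. *)
Lemma lin_span_kernel l (S : set 'rV[R]_l) :
  exists K : 'M[R]_l, forall v, lin_span S v <-> v *m K = 0.
Proof.
pose P k := `[< exists s : seq 'rV[R]_l, {in s, forall x, S x} /\ \dim (span s) = k >].
have P0 : exists k, P k by exists 0%N; apply/asboolP; exists [::]; rewrite span_nil dimv0.
have Pmax k : P k -> (k <= \dim {: 'rV[R]_l})%N.
  by move=> /asboolP[s [_ <-]]; exact: dimvS (subvf _).
have [k /asboolP[s [sS sk]] kmax] := ex_maxnP P0 Pmax.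
exists (lin1_mx (\1%VF - projv (span s))%VF) => v.
rewrite mul_rV_lin1 /= add_lfunE opp_lfunE id_lfunE; split; last first.
  move=> /subr0_eq vE; exists s; split=> //; rewrite vE; exact: memv_proj.
move=> [s' [s'S vs']]; apply/eqP; rewrite subr_eq0 eq_sym; apply/eqP/projv_id.
have le_ss' : ((span s) <= (span (s ++ s')))%VS by rewrite span_cat addvSl.
have /eqP -> : (span s)%VS == (span (s ++ s'))%VS.
  rewrite eqEdim le_ss' sk kmax//; apply/asboolP; exists (s ++ s'); split=> //.
  by move=> x; rewrite mem_cat => /orP[/sS|/s'S].
by rewrite span_cat; apply: subvP vs'; exact: addvSr.
Qed.

Lemma down_to_0_harmonic : down_to_0 (fun k => k.+1%:R^-1 : R).
Proof. by split=> [k|]; [rewrite invr_gt0 ltr0n|exact: cvg_harmonic]. Qed.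

Lemma tangent0 l (D : set 'rV[R]_l) d : D d -> tangent D d 0.
Proof.
move=> Dd; exists (fun k => k.+1%:R^-1), (fun=> 0); split=> [||k].
- exact: down_to_0_harmonic.
- exact: cvg_cst.
- by rewrite scaler0 addr0.
Qed.

Lemma tangent_splus l (D : set 'rV[R]_l) d :
  D d -> tangent D d `<=` splus (tangent D d).
Proof.
move=> Dd u Tu; exists [:: u]; split; last by rewrite memv_span// mem_head.
move=> x; rewrite inE => /eqP ->; exists u => //; exists 0; first exact: tangent0.
by rewrite subr0.
Qed.

Lemma convex_polyhedral_closed l (C : set 'rV[R]_l) :
  convex_polyhedral C -> closed C.
Proof.
move=> [p [A [b ->]]].
rewrite (_ : mkset _ = \bigcap_j [set x | (x *m A) 0 j <= b 0 j]); last first.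
  by apply/seteqP; split=> x /= xC j => [_|]; exact: xC.
apply: closed_bigI => j _.
suff : closed ((fun x : 'rV[R]_l => (x *m A) 0 j) @^-1` [set r | r <= b 0 j]) by [].
apply: preimage_closed; last exact: closed_le.
move=> x _; apply: (cvg_comp (fun x : 'rV_l => x *m A) (fun M => M 0 j)).
  exact: mulmxr_continuous.
exact: coord_continuous.
Qed.

Lemma convex_polyhedral_convex l (C : set 'rV[R]_l) x y s :
  convex_polyhedral C -> C x -> C y -> 0 <= s <= 1 -> C (x + s *: (y - x)).
Proof.
move=> [p [A [b ->]]] /= xC yC /andP[s0 s1] j.
rewrite mulmxDl -scalemxAl mulmxBl !mxE.
have := xC j; have := yC j; rewrite !mxE; nra.
Qed.

(** There are finitely many pieces and each is closed, so near [d] only the pieces containing [d]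
    matter. If [y] lies in such a piece, convexity keeps the segment from [d] to [y] inside it, and
    the constant direction [y - d] with steps [1 / (k + 1) <= 1] witnesses tangency. *)
Lemma polyhedral_near_tangent l (D : set 'rV[R]_l) d :
  polyhedral D -> \forall y \near d, D y -> tangent D d (y - d).
Proof.
move=> [N [C [Cpoly ->]]].
have : \forall y \near d, forall i, C i y -> C i d.
  apply: (filter_forall (F := nbhs d)) => i; have [Cid|nCid] := pselect (C i d).
    exact: nearW.
  have nC := open_nbhs_nbhs (conj (closed_openC (convex_polyhedral_closed (Cpoly i))) nCid).
  by apply: filterS nC => y nCy Cy; have := nCy Cy.
apply: filterS => y Cy [i _ Ciy]; have Cid := Cy _ Ciy.
exists (fun k => k.+1%:R^-1), (fun=> y - d); split=> [||k].
- exact: down_to_0_harmonic.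
- exact: cvg_cst.
- exists i => //; apply: convex_polyhedral_convex => //.
  by rewrite invr_ge0 ler0n invf_le1 ?ltr0n// ler1n.
Qed.
End Polyhedral.

(** * First and second order Taylor remainders *)

Section Taylor.
Context {R : realType}.

Lemma differential_expansion n m (F : 'rV[R]_n -> 'rV[R]_m) z (e : R) :
  differentiable F z -> 0 < e ->
  \forall h \near (0 : 'rV[R]_n), `|F (z + h) - F z - 'd F z h| <= e * `|h|.
Proof.
move=> dF e0; move/eqaddoP: (diff_locally dF) => /(_ e e0).
by apply: filterS => h; rewrite /= !fctE /= opprD addrA (addrC h).
Qed.

(** The exponent serves both expansions, with [p = 1] and [p = 2]. Once [|w k| <= M], the remainder
    at [t k *: w k] is at most [e * (t k * M) ^+ p], and [t k ^+ p] cancels. *)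
Lemma remainder_cvg n m p (E : 'rV[R]_n -> 'rV[R]_m) (t : nat -> R)
    (w : nat -> 'rV[R]_n) :
  (forall e, 0 < e -> \forall h \near (0 : 'rV[R]_n), `|E h| <= e * `|h| ^+ p) ->
  down_to_0 t -> bounded_near w \oo ->
  (fun k => (t k ^+ p)^-1 *: E (t k *: w k)) @ \oo --> (0 : 'rV[R]_m).
Proof.
move=> Ep [t0 tcvg] [M0 [_ /(_ (Num.max (M0 + 1) 1))]].
rewrite lt_max ltrDl ltr01 => /(_ isT); set M := Num.max _ _ => wM.
have M0_gt0 : 0 < M by rewrite lt_max ltr01 orbT.
apply/cvgrPdist_le => e e0.
(* The maximum with 1 makes [M] positive; dividing by [M ^+ p] absorbs the bound on the
   directions. *)
have e'0 : 0 < e / M ^+ p by rewrite divr_gt0// exprn_gt0.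
have /nbhs_normP[r /= r0 Er] := Ep _ e'0.
have tr : \forall k \near \oo, t k < r / M.
  by apply: (cvgr_lt 0) => //; rewrite divr_gt0.
near=> k.
have wk : `|w k| <= M by near: k.
have tk : t k < r / M by near: k.
rewrite sub0r normrN normrZ normfV normrX (gtr0_norm (t0 k)).
rewrite ler_pdivrMl ?exprn_gt0//.
have tw : `|t k *: w k| <= t k * M by rewrite normrZ (gtr0_norm (t0 k)) ler_pM2l.
apply: (le_trans (Er _ _)).
  rewrite /ball_ /= sub0r normrN (le_lt_trans tw)//.
  by rewrite -ltr_pdivlMr.
rewrite mulrAC ler_pdivrMr ?exprn_gt0// [_ * e]mulrC -mulrA ler_pM2l// -exprMn lerXn2r// ?nnegrE//.
by rewrite mulr_ge0// ltW.
Unshelve. all: end_near. Qed.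

Lemma linear_rV_sum n m (f : {linear 'rV[R]_n -> 'rV[R]_m}) h :
  f h = \sum_k h 0 k *: f (delta_mx 0 k).
Proof. by rewrite {1}(row_sum_delta h) linear_sum; under eq_bigr do rewrite linearZ. Qed.

Lemma differential_coord n m (F : 'rV[R]_n -> 'rV[R]_m) x h i :
  differentiable F x ->
  'd F x h 0 i = \sum_k h 0 k * 'D_(delta_mx 0 k) F x 0 i.
Proof.
move=> dF; rewrite linear_rV_sum summxE; apply: eq_bigr => k _.
by rewrite mxE deriveE.
Qed.

Lemma derive_coord n m (F : 'rV[R]_n -> 'rV[R]_m) u i :
  (forall x, differentiable F x) ->
  'D_u (fun x => F x 0 i) = fun x => 'D_u F x 0 i.
Proof.
by move=> dF; apply/funext => x; rewrite derive_mx ?mxE//; exact: diff_derivable.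
Qed.

(** Expresses the quadratic form through differentials of the partial derivatives, the shape in
    which their first order remainders appear in the second order expansion. *)
Lemma hess2_coord n m (F : 'rV[R]_n -> 'rV[R]_m) z w i :
  twice_continuously_differentiable F ->
  hess2 F z w 0 i = \sum_k w 0 k * ('d ('D_(delta_mx 0 k) F) z w) 0 i.
Proof.
move=> [dF dDF]; rewrite mxE mxE; apply: eq_bigr => k _.
rewrite mulrC mxE; congr (_ * _); rewrite mxE linear_rV_sum summxE.
apply: eq_bigr => j _; rewrite !mxE derive_coord//; congr (_ * _).
have DDF := @derive_coord _ _ ('D_(delta_mx 0 k) F) (delta_mx 0 j) i (dDF _).1.
apply: (etrans (congr1 (@^~ z) DDF)).
by rewrite deriveE//; exact: (dDF _).1.
Qed.

Lemma hess2Z n m (F : 'rV[R]_n -> 'rV[R]_m) z a w :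
  hess2 F z (a *: w) = a ^+ 2 *: hess2 F z w.
Proof.
apply/rowP => i; rewrite mxE [RHS]mxE [X in _ * X]mxE.
by rewrite -scalemxAl linearZ/= -scalemxAl -scalemxAr scalerA -expr2 mxE.
Qed.

(** The difference quotients of the restriction to the line at [s] are literally those of [F] at
    [z + s *: h] in direction [h]. *)
Lemma is_derive_line n m (F : 'rV[R]_n -> 'rV[R]_m) z h (s : R) i :
  (forall x, differentiable F x) ->
  is_derive s 1 (fun s : R => F (z + s *: h) 0 i) ('d F (z + s *: h) h 0 i).
Proof.
move=> dF; have E : (fun x : R => x^-1 *: (((fun s : R => F (z + s *: h)) \o shift s) (x *: 1)
    - F (z + s *: h))) =
  (fun x : R => x^-1 *: ((F \o shift (z + s *: h)) (x *: h) - F (z + s *: h))).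
  apply/funext => x; congr (_ *: (F _ - _)).
  by rewrite /= [x *: 1]mulr1 scalerDl addrCA.
have dl : @derivable R R^o _ (fun s : R => F (z + s *: h)) s 1.
  by rewrite /derivable E; exact: diff_derivable.
have Dl : 'D_1 (fun s : R => F (z + s *: h)) s = 'd F (z + s *: h) h.
  by rewrite -(deriveE h (dF _)) /derive E.
split; first exact: (derivable_mxP _ _ _).1 dl 0 i.
by rewrite -Dl derive_mx// mxE.
Qed.

Lemma is_derive_sub_quadratic (f : R -> R) (s df a b : R) :
  is_derive s 1 f df ->
  is_derive s 1 (fun s => f s - (s * a + s ^+ 2 * (2^-1 * b))) (df - (a + s * b)).
Proof.
move=> ?; apply: is_derive_eq.
have scaleE (x y : R) : x *: (y : R^o) = x * y by [].
by rewrite !scaleE; field.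
Qed.

(* The mean value theorem is applied once, to the coordinates of
   [s |-> F (z + s h) - s F'(z) h - s^2/2 F''(z)(h, h)]; its derivative is a
   combination of first order remainders of the partial derivatives. *)
Lemma second_order_expansion n m (F : 'rV[R]_n -> 'rV[R]_m) z (e : R) :
  twice_continuously_differentiable F -> 0 < e ->
  \forall h \near (0 : 'rV[R]_n),
    `|F (z + h) - F z - 'd F z h - 2^-1 *: hess2 F z h| <= e * `|h| ^+ 2.
Proof.
move=> FC2 e0; have [dF dDF] := FC2.
pose P k (y : 'rV[R]_n) := 'D_(delta_mx 0 k) F (z + y)
  - 'D_(delta_mx 0 k) F z - 'd ('D_(delta_mx 0 k) F) z y.
(* The final sum has [n] terms; dividing by [n + 1] rather than [n] also covers [n = 0]. *)
have e'0 : 0 < e / n.+1%:R by rewrite divr_gt0.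
have /nbhs_normP[r /= r0 Pr] : \forall y \near (0 : 'rV[R]_n),
    forall k, `|P k y| <= e / n.+1%:R * `|y|.
  apply: (filter_forall (F := nbhs (0 : 'rV[R]_n))) => k; apply: differential_expansion => //.
  exact: (dDF _).1.
apply/nbhs_normP; exists r => //= h; rewrite /ball_ /= sub0r normrN => hr.
apply: rV_norm_le => [|i]; first by rewrite mulr_ge0 ?exprn_ge0// ltW.
pose g (s : R) := F (z + s *: h) 0 i - (s * 'd F z h 0 i + s ^+ 2 * (2^-1 * hess2 F z h 0 i)).
pose dg (s : R) := 'd F (z + s *: h) h 0 i - ('d F z h 0 i + s * hess2 F z h 0 i).
have gdg (s : R) : is_derive s 1 g (dg s).
  by apply: is_derive_sub_quadratic; exact: is_derive_line.
have gcont : {within `[0, 1], continuous g}.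
  apply: continuous_subspaceT => x; apply: differentiable_continuous.
  by apply/derivable1_diffP; exact: ex_derive.
have [c] := MVT_segment ler01 (fun x _ => gdg x) gcont.
rewrite in_itv/= => /andP[c0 c1]; rewrite subr0 mulr1 => gE.
have -> : (F (z + h) - F z - 'd F z h - 2^-1 *: hess2 F z h) 0 i = g 1 - g 0.
  rewrite /g scale1r scale0r addr0 expr1n expr0n/= !mul1r !mul0r addr0 subr0.
  by rewrite !mxE; ring.
have -> : g 1 - g 0 = \sum_k h 0 k * P k (c *: h) 0 i.
  have PE k : P k (c *: h) 0 i = 'D_(delta_mx 0 k) F (z + c *: h) 0 i
      - 'D_(delta_mx 0 k) F z 0 i - c * 'd ('D_(delta_mx 0 k) F) z h 0 i.
    by rewrite /P linearZ !mxE.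
  have dgE := congr2 (fun a b => a - b) (differential_coord h i (dF (z + c *: h)))
    (congr2 (fun a b => a + c * b) (differential_coord h i (dF z)) (hess2_coord z h i FC2)).
  rewrite gE; apply: (etrans dgE).
  rewrite mulr_sumr -big_split -sumrB; apply: eq_bigr => k _.
  by rewrite PE !mulrBr opprD addrA mulrCA.
(* The intermediate point [c] lies in [0, 1], so [c *: h] stays in the ball where [P] is
   controlled. *)
have hn : `|c *: h| <= `|h| by rewrite normrZ ger0_norm// ler_piMl.
apply: (le_trans (ler_norm_sum _ _ _)).
apply: (@le_trans _ _ (\sum_(k < n) `|h| * (e / n.+1%:R * `|h|))).
  apply: ler_sum => k _; rewrite normrM ler_pM ?coord_le_norm//.
  apply: (le_trans (coord_le_norm _ _)).
  apply: (le_trans (Pr _ _ k)); first by rewrite /ball_ /= sub0r normrN (le_lt_trans hn).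
  by rewrite ler_pM2l.
rewrite sumr_const card_ord.
have -> : `|h| * (e / n.+1%:R * `|h|) *+ n = n%:R / n.+1%:R * (e * `|h| ^+ 2).
  by rewrite -[LHS]mulr_natl; ring.
rewrite ler_piMl ?mulr_ge0 ?exprn_ge0 ?(ltW e0)//.
by rewrite ler_pdivrMr// mul1r ler_nat.
Qed.

End Taylor.

(** * Tangent sequences and limits of difference quotients *)

Section Sequences.
Context {R : realType}.

Lemma near_shift (P : set nat) :
  (\forall k \near \oo, P k) -> exists N, forall k, P (k + N)%N.
Proof. by move=> [N _ NP]; exists N => k; apply: NP => /=; rewrite leq_addl. Qed.

Lemma near_cvg (V : topologicalType) (u v : nat -> V) (l : V) :
  (\forall k \near \oo, u k = v k) -> u @ \oo --> l -> v @ \oo --> l.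
Proof.
move=> uv ul A /ul uA; rewrite /nbhs/=.
by apply: filterS2 uv uA => k /= <-.
Qed.

Lemma cvg_addn (V : ptopologicalType) (u : nat -> V) (l : V) N :
  u @ \oo --> l -> (fun k => u (k + N)%N) @ \oo --> l.
Proof. by rewrite -(cvg_shiftn N). Qed.

Lemma down_to_0_addn (t : nat -> R) N :
  down_to_0 t -> down_to_0 (fun k => t (k + N)%N).
Proof. by move=> [t0 tcvg]; split=> [k|]; [exact: t0|exact: cvg_addn]. Qed.

(** [tangent] asks for membership at every index while constructions give it eventually; dropping
    finitely many terms bridges the gap. *)
Lemma near_tangent n (C : set 'rV[R]_n) z u (t : nat -> R) (u_ : nat -> 'rV[R]_n) :
  down_to_0 t -> u_ @ \oo --> u -> (\forall k \near \oo, C (z + t k *: u_ k)) ->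
  tangent C z u.
Proof.
move=> t0 uu /near_shift[N CN].
exists (fun k => t (k + N)%N), (fun k => u_ (k + N)%N); split=> //.
  exact: down_to_0_addn.
exact: cvg_addn.
Qed.

Lemma near_tangent2 n (C : set 'rV[R]_n) z u w (t : nat -> R) (w_ : nat -> 'rV[R]_n) :
  down_to_0 t -> w_ @ \oo --> w ->
  (\forall k \near \oo, C (z + t k *: u + (2^-1 * t k ^+ 2) *: w_ k)) ->
  tangent2 C z u w.
Proof.
move=> t0 ww /near_shift[N CN].
exists (fun k => t (k + N)%N), (fun k => w_ (k + N)%N); split=> //.
  exact: down_to_0_addn.
exact: cvg_addn.
Qed.

Lemma cvg_scale0 n (t : nat -> R) (u : nat -> 'rV[R]_n) :
  down_to_0 t -> bounded_near u \oo -> (fun k => t k *: u k) @ \oo --> (0 : 'rV[R]_n).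
Proof.
move=> [t0 tcvg] /ex_strict_bound_gt0[M M0 uM]; apply/cvgrPdist_lt => e e0.
have te : \forall k \near \oo, t k < e / M by apply: (cvgr_lt 0) => //; exact: divr_gt0.
apply: filterS2 te uM => k tk uk; rewrite sub0r normrN normrZ (gtr0_norm (t0 k)).
rewrite (@lt_trans _ _ (t k * M)) ?ltr_pM2l//.
by rewrite -ltr_pdivlMr.
Qed.

Lemma cvg_second_order_step n (t : nat -> R) (v_ : nat -> 'rV[R]_n) (v w : 'rV[R]_n) :
  down_to_0 t -> v_ @ \oo --> v ->
  (fun k => w + (2^-1 * t k) *: v_ k) @ \oo --> w.
Proof.
move=> t0 v_cvg.
have := cvgD (cvg_cst w) (cvgZl_tmp (k := 2^-1) (cvg_scale0 t0 (cvg_bounded _ _ v_cvg))).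
rewrite scaler0 addr0 => /(_ _ _ _ _); apply: near_cvg; apply: nearW => k.
by rewrite -scalerA.
Qed.

(** A second order path is a first order path with a perturbed direction, so first order results
    apply to it. *)
Lemma second_order_pointE n (z w v : 'rV[R]_n) (s : R) :
  z + s *: w + (2^-1 * s ^+ 2) *: v = z + s *: (w + (2^-1 * s) *: v).
Proof. by rewrite scalerDr scalerA addrA expr2 mulrCA. Qed.

(** Only boundedness of [u] is asked: the result is applied to quotients of [zhat] before their
    convergence is known. *)
Lemma first_order_quotient n m (F : 'rV[R]_n -> 'rV[R]_m) z
    (t : nat -> R) (u : nat -> 'rV[R]_n) :
  differentiable F z -> down_to_0 t -> bounded_near u \oo ->
  (fun k => (t k)^-1 *: (F (z + t k *: u k) - F z) - 'd F z (u k)) @ \oo -->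
    (0 : 'rV[R]_m).
Proof.
move=> dF t0 ub.
have := @remainder_cvg _ _ _ 1 (fun h => F (z + h) - F z - 'd F z h) t u _ t0 ub.
rewrite (_ : (fun k => _) = fun k => (t k)^-1 *: (F (z + t k *: u k) - F z) - 'd F z (u k)).
  by apply=> e e0; exact: differential_expansion.
apply/funext => k; have -> : 'd F z (t k *: u k) = t k *: 'd F z (u k) by exact: linearZ.
by rewrite expr1 scalerBr scalerA mulVf ?scale1r// gt_eqF// t0.1.
Qed.

(** The expansion is taken at [z] along the directions [w + (t k / 2) *: v k]. Their convergence to
    [w] is the sole control on [v], which may be unbounded here: the term linear in [v k] is
    subtracted exactly. *)
Lemma second_order_quotient n m (F : 'rV[R]_n -> 'rV[R]_m) z w
    (t : nat -> R) (v : nat -> 'rV[R]_n) :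
  twice_continuously_differentiable F -> down_to_0 t ->
  (fun k => w + (2^-1 * t k) *: v k) @ \oo --> w ->
  (fun k => (2^-1 * t k ^+ 2)^-1 *:
     (F (z + t k *: w + (2^-1 * t k ^+ 2) *: v k) - F z - t k *: 'd F z w)
     - 'd F z (v k)) @ \oo --> hess2 F z w.
Proof.
move=> FC2 t0 uw; pose u k := w + (2^-1 * t k) *: v k.
have ub : bounded_near u \oo by exact: cvg_bounded uw.
pose E h := F (z + h) - F z - 'd F z h - 2^-1 *: hess2 F z h.
have E0 : (fun k => (t k ^+ 2)^-1 *: E (t k *: u k)) @ \oo --> (0 : 'rV[R]_m).
  by apply: remainder_cvg => // e e0; exact: second_order_expansion.
have hu : hess2 F z (u k) @[k --> \oo] --> hess2 F z w.
  apply: cvg_rV => i; rewrite mxE; under eq_fun do rewrite mxE.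
  exact: (cvg_comp u (fun v => (v *m hessian (fun x => F x 0 i) z *m v^T) 0 0)
    uw (@quadratic_continuous _ _ _ _)).
(* The factor 2 passes from division by [t k ^+ 2] to division by half of it. *)
have := cvgD (cvgZl_tmp (k := 2) E0) hu.
rewrite scaler0 add0r; move=> /(_ _ _); apply: near_cvg; apply: nearW => k /=.
have tk0 : t k != 0 by rewrite gt_eqF// t0.1.
have dE : 'd F z (t k *: u k) = t k *: 'd F z w + (2^-1 * t k ^+ 2) *: 'd F z (v k).
  by rewrite /u -!linearZ -linearD scalerDr scalerA expr2 (mulrCA (t k)).
rewrite fctE second_order_pointE -/(u k) /E/=.
rewrite hess2Z dE.
move: (F (z + _)) (F z) ('d F z w) ('d F z (v k)) (hess2 F z (u k)) => a b c d H.
by apply/rowP => i; rewrite !mxE; field.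
Qed.

Lemma differential_cvg n p (F : 'rV[R]_n -> 'rV[R]_p) z
    (u_ : nat -> 'rV[R]_n) (u : 'rV[R]_n) :
  u_ @ \oo --> u -> (fun k => 'd F z (u_ k)) @ \oo --> 'd F z u.
Proof.
move=> uu; rewrite -mul_rV_lin1.
apply: near_cvg
  (cvg_comp u_ (fun x => x *m lin1_mx ('d F z)) uu (@mulmxr_continuous _ _ _ _ _)).
by apply: nearW => k; rewrite /= mul_rV_lin1.
Qed.

End Sequences.

(** * The linear system defining [what] and its left inverse *)

Section LinearInverse.
Context {R : realType} {n m l : nat}.
Context (B : 'rV[R]_n -> 'rV[R]_m) (G : 'rV[R]_n -> 'rV[R]_l) (D : set 'rV[R]_l).
Context (z : 'rV[R]_n).
Context (inj : forall w, Llin G D z w -> 'd B z w = 0 -> w = 0).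

Lemma psi_invE eta q w :
  psi_inv B G D z (eta, q) w <->
  'd B z w = eta /\ splus (tangent D (G z)) ('d G z w - q).
Proof.
split=> [[[d1 d2] /= [-> Sd2] [<- <-]]|[<- Sw]].
  by rewrite subr0; split=> //; apply: (eq_ind d2 _ Sd2); exact/esym/subKr.
exists (0, 'd G z w - q) => //=; congr pair; first by rewrite subr0.
exact: subKr.
Qed.

(** With [K] annihilating exactly the subspace, [inj] says that [w |-> ('d B z w, 'd G z w *m K)]
    has trivial kernel. Its matrix is therefore row free, and [N1], [N2] are the two blocks of a
    right inverse. *)
Lemma linear_left_inverse : exists (K : 'M[R]_l) (N1 : 'M[R]_(m, n)) (N2 : 'M[R]_(l, n)),
  (forall v, splus (tangent D (G z)) v <-> v *m K = 0) /\
  forall w, w = 'd B z w *m N1 + 'd G z w *m K *m N2.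
Proof.
have [K KE] := lin_span_kernel [set x - y | x in tangent D (G z) & y in tangent D (G z)].
have /row_freeP[N NE] : row_free (row_mx (lin1_mx ('d B z)) (lin1_mx ('d G z) *m K)).
  apply: inj_row_free => v; rewrite mul_mx_row mulmxA !mul_rV_lin1 => /eqP.
  by rewrite row_mx_eq0 => /andP[/eqP v1 /eqP v2]; apply: inj => //; apply/KE.
exists K, (usubmx N), (dsubmx N); split=> // w.
rewrite -mul_row_col vsubmxK -[in RHS](mul_rV_lin1 ('d B z)) -[in RHS](mul_rV_lin1 ('d G z)).
by rewrite -mulmxA -mul_mx_row -mulmxA NE mulmx1.
Qed.

(** Any solution equals [eta *m N1 + q *m K *m N2], so one solution suffices to make the choice in
    [what] unambiguous. *)
Lemma psi_inv_what eta q w : psi_inv B G D z (eta, q) w ->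
  psi_inv B G D z (eta, q) = [set what B G D z (eta, q)] /\ what B G D z (eta, q) = w.
Proof.
move=> zw; have [K [N1 [N2 [KE NE]]]] := linear_left_inverse.
have E w' : psi_inv B G D z (eta, q) w' -> w' = eta *m N1 + q *m K *m N2.
  move=> /psi_invE[<- /KE]; rewrite mulmxBl => /subr0_eq <-; exact: NE.
have zwhat : psi_inv B G D z (eta, q) (what B G D z (eta, q)) := getI zw.
have whatE : what B G D z (eta, q) = w by rewrite (E _ zwhat) (E _ zw).
split=> //; rewrite whatE; apply/seteqP; split=> [w' /E ->|w' ->//].
by rewrite /= (E _ zw).
Qed.

(* Solutions of the perturbed system converge because a left inverse of the
   injective linear map [w |-> (B'(z) w, G'(z) w mod T_D(G z)^+)] is continuous. *)
Lemma cvg_psi_inv (w_ : nat -> 'rV[R]_n) (eta_ : nat -> 'rV[R]_m)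
    (q_ : nat -> 'rV[R]_l) (eta : 'rV[R]_m) (q : 'rV[R]_l) :
  eta_ @ \oo --> eta -> q_ @ \oo --> q ->
  (\forall k \near \oo, psi_inv B G D z (eta_ k, q_ k) (w_ k)) ->
  w_ @ \oo --> what B G D z (eta, q) /\
  psi_inv B G D z (eta, q) = [set what B G D z (eta, q)].
Proof.
move=> eta_cvg q_cvg w_near; have [K [N1 [N2 [KE NE]]]] := linear_left_inverse.
pose w := eta *m N1 + q *m K *m N2.
have mulmx_cvg p r (x_ : nat -> 'rV[R]_p) (x : 'rV[R]_p) (N : 'M[R]_(p, r)) :
    x_ @ \oo --> x -> (fun k => x_ k *m N) @ \oo --> x *m N.
  by move=> xx; apply: (cvg_comp x_ (fun x => x *m N) xx); exact: mulmxr_continuous.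
have w_cvg : w_ @ \oo --> w.
  have := cvgD (mulmx_cvg _ _ _ _ N1 eta_cvg) (mulmx_cvg _ _ _ _ N2 (mulmx_cvg _ _ _ _ K q_cvg)).
  move=> /(_ _ _); apply: near_cvg; apply: filterS w_near => k /psi_invE[dB /KE].
  by rewrite mulmxBl => /subr0_eq dG; rewrite (NE (w_ k)) dB dG.
(* Solvability for the limiting right-hand side is not assumed: both equations pass to the limit,
   membership in the subspace being the closed condition of annihilation by [K]. *)
have zw : psi_inv B G D z (eta, q) w.
  apply/psi_invE; split.
    apply: cvg_unique (differential_cvg (F := B) w_cvg) _ => //.
    by apply: near_cvg eta_cvg; apply: filterS w_near => k /psi_invE[].
  apply/KE; rewrite mulmxBl; apply/eqP; rewrite subr_eq0; apply/eqP.
  apply: cvg_unique (mulmx_cvg _ _ _ _ K (differential_cvg (F := G) w_cvg)) _ => //.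
  apply: near_cvg (mulmx_cvg _ _ _ _ K q_cvg); apply: filterS w_near => k /psi_invE[_ /KE].
  by rewrite mulmxBl => /subr0_eq ->.
by have [-> ->] := psi_inv_what zw.
Qed.

End LinearInverse.

(** * Uniqueness of directional derivatives *)

Section DirectionalDerivatives.
Context {R : realType} {n m : nat}.
Context (S : set 'rV[R]_m) (f : 'rV[R]_m -> 'rV[R]_n) (omega : 'rV[R]_m).

(** Tangency supplies an admissible sequence; without one every vector would satisfy [is_dirder]
    vacuously and [get] would pick an arbitrary one. *)
Lemma dirder_unique eta l : tangent S omega eta -> is_dirder S f omega eta l ->
  dirder S f omega eta = l /\ is_dirder S f omega eta (dirder S f omega eta).
Proof.
move=> [t [eta_ [t0 eta_cvg Seta]]] fl.
have fd : is_dirder S f omega eta (dirder S f omega eta) := getI fl.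
by split=> //; exact: cvg_unique (fd _ _ t0 eta_cvg Seta) (fl _ _ t0 eta_cvg Seta).
Qed.

Lemma dirder2_unique eta xi l : tangent2 S omega eta xi ->
  is_dirder2 S f omega eta xi l ->
  dirder2 S f omega eta xi = l /\
  is_dirder2 S f omega eta xi (dirder2 S f omega eta xi).
Proof.
move=> [t [xi_ [t0 xi_cvg Sxi]]] fl.
have fd : is_dirder2 S f omega eta xi (dirder2 S f omega eta xi) := getI fl.
by split=> //; exact: cvg_unique (fd _ _ t0 xi_cvg Sxi) (fl _ _ t0 xi_cvg Sxi).
Qed.

End DirectionalDerivatives.

(** * First and second order behaviour of [zhat] at a base point written [B z] *)

Section LocalInverse.
Context {R : realType} {n m l : nat}.
Context (B : 'rV[R]_n -> 'rV[R]_m) (G : 'rV[R]_n -> 'rV[R]_l) (D : set 'rV[R]_l).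
Context (B_C2 : twice_continuously_differentiable B).
Context (G_C2 : twice_continuously_differentiable G).
Context (D_poly : polyhedral D).
Context (z : 'rV[R]_n) (zhat : 'rV[R]_m -> 'rV[R]_n) (M : R).
Context (Dz : D (G z)).
Context (inj : forall w, Llin G D z w -> 'd B z w = 0 -> w = 0).
Context (zhatz : zhat (B z) = z).
Context (zhat_loc : \forall o \near B z, Omega B G D o ->
  [/\ B (zhat o) = o, D (G (zhat o)) & `|zhat o - z| <= M * `|o - B z|]).

Lemma splus_linear_combination (S : set 'rV[R]_l) a b r s :
  splus S a -> splus S b -> splus S (r *: (a - s *: b)).
Proof.
have [K KE] := lin_span_kernel [set x - y | x in S & y in S].
move=> /KE aK /KE bK; apply/KE.
by rewrite -scalemxAl mulmxBl -scalemxAl aK bK scaler0 subr0 scaler0.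
Qed.

(** Polyhedrality makes the membership exact rather than asymptotic, so it survives division by
    [t k] and even by [t k ^+ 2]. *)
Lemma near_difference_splus (t : nat -> R) (u : nat -> 'rV[R]_n) :
  down_to_0 t -> bounded_near u \oo -> (\forall k \near \oo, D (G (z + t k *: u k))) ->
  \forall k \near \oo, splus (tangent D (G z)) (G (z + t k *: u k) - G z).
Proof.
move=> t0 ub Dk.
have zk : (fun k => z + t k *: u k) @ \oo --> z.
  have := cvgD (cvg_cst z) (cvg_scale0 t0 ub).
  by rewrite addr0; apply.
have Gk : (fun k => G (z + t k *: u k)) @ \oo --> G z.
  exact: (cvg_comp _ G zk (differentiable_continuous (G_C2.1 z))).
have := Gk _ (polyhedral_near_tangent (G z) D_poly).
rewrite /nbhs/=; apply: filterS2 Dk => k Dk Tk; exact/tangent_splus/Tk.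
Qed.

Lemma tangent_image w :
  tangent (Gamma G D) z w -> tangent (Omega B G D) (B z) ('d B z w).
Proof.
move=> [t [w_ [t0 w_cvg Gw]]].
exists t, (fun k => (t k)^-1 *: (B (z + t k *: w_ k) - B z)); split=> // [|k].
  have := cvgD (first_order_quotient (B_C2.1 z) t0 (cvg_bounded _ _ w_cvg))
    (differential_cvg (F := B) (z := z) w_cvg).
  rewrite add0r => /(_ _ _); apply: near_cvg; apply: nearW => k.
  exact: subrK.
exists (z + t k *: w_ k); first exact: Gw.
by rewrite /= scalerA divff ?scale1r ?gt_eqF ?t0.1// [RHS]addrC subrK.
Qed.

(** The Lipschitz estimate bounds the quotients [w_], which makes the first order remainders vanish;
    [w_] then solves the system with right-hand sides tending to [(eta, 0)]. *)
Lemma zhat_first_order t (eta_ : nat -> 'rV[R]_m) (eta : 'rV[R]_m) :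
  down_to_0 t -> eta_ @ \oo --> eta ->
  (forall k, Omega B G D (B z + t k *: eta_ k)) ->
  let w_ k := (t k)^-1 *: (zhat (B z + t k *: eta_ k) - z) in
  [/\ \forall k \near \oo, B (z + t k *: w_ k) = B z + t k *: eta_ k /\
        Gamma G D (z + t k *: w_ k),
      w_ @ \oo --> what B G D z (eta, 0) &
      psi_inv B G D z (eta, 0) = [set what B G D z (eta, 0)]].
Proof.
move=> t0 eta_cvg Ok w_; have eta_b : bounded_near eta_ \oo by exact: cvg_bounded eta_cvg.
have zw k : z + t k *: w_ k = zhat (B z + t k *: eta_ k).
  by rewrite /w_ scalerA divff ?scale1r ?gt_eqF ?t0.1// [LHS]addrC subrK.
have oz : (fun k => B z + t k *: eta_ k) @ \oo --> B z.
  by have := cvgD (cvg_cst (B z)) (cvg_scale0 t0 eta_b); rewrite addr0; apply.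
have loc : \forall k \near \oo, [/\ B (z + t k *: w_ k) = B z + t k *: eta_ k,
    D (G (z + t k *: w_ k)) & `|w_ k| <= M * `|eta_ k|].
  have := oz _ zhat_loc; rewrite /nbhs/=; apply: filterS => k /(_ (Ok k)) [? ? le].
  rewrite zw; split=> //.
  rewrite /w_ normrZ normfV gtr0_norm ?t0.1// ler_pdivrMl ?t0.1//.
  apply: (le_trans le); rewrite addrAC subrr add0r normrZ gtr0_norm ?t0.1//.
  by rewrite mulrCA.
have w_b : bounded_near w_ \oo.
  apply/ex_bound; have /ex_bound[C etaC] := eta_b; exists (`|M| * C).
  apply: filterS2 etaC loc => k /= etaC [_ _ wk]; apply: (le_trans wk).
  apply: (@le_trans _ _ (`|M| * `|eta_ k|)); last by rewrite ler_wpM2l.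
  by rewrite ler_wpM2r// ler_norm.
have locD : \forall k \near \oo, D (G (z + t k *: w_ k)) by apply: filterS loc => k [].
pose c p (F : 'rV[R]_n -> 'rV[R]_p) k :=
  (t k)^-1 *: (F (z + t k *: w_ k) - F z) - 'd F z (w_ k).
have cB : (fun k => eta_ k - c _ B k) @ \oo --> eta.
  have := cvgB eta_cvg (first_order_quotient (B_C2.1 z) t0 w_b).
  by rewrite subr0; apply.
have cG : (fun k => - c _ G k) @ \oo --> (0 : 'rV[R]_l).
  have := cvgN (first_order_quotient (G_C2.1 z) t0 w_b).
  by rewrite oppr0; apply.
have sol : \forall k \near \oo, psi_inv B G D z (eta_ k - c _ B k, - c _ G k) (w_ k).
  apply: filterS2 loc (near_difference_splus t0 w_b locD) => k [Bk _ _] Sk.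
  apply/psi_invE; split.
    rewrite /c Bk addrAC subrr add0r scalerA mulVf ?gt_eqF ?t0.1//.
    by rewrite scale1r subKr.
  rewrite opprK /c addrC subrK.
  (* Division by [t k] is the linear combination whose second vector is 0. *)
  have S0 : splus (tangent D (G z)) 0 by apply: tangent_splus => //; exact: tangent0.
  by have := splus_linear_combination (t k)^-1 0 Sk S0; rewrite scaler0 subr0.
have [wcvg wset] := cvg_psi_inv inj cB cG sol.
by split=> //; apply: filterS loc => k [].
Qed.

Lemma what_tangent eta : tangent (Omega B G D) (B z) eta ->
  [/\ psi_inv B G D z (eta, 0) = [set what B G D z (eta, 0)],
      tangent (Gamma G D) z (what B G D z (eta, 0)) &
      'd B z (what B G D z (eta, 0)) = eta].
Proof.
move=> [t [eta_ [t0 eta_cvg Ok]]].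
have [loc w_cvg wset] := zhat_first_order t0 eta_cvg Ok.
split=> //; first by apply: near_tangent t0 w_cvg _; apply: filterS loc => k [].
have : psi_inv B G D z (eta, 0) (what B G D z (eta, 0)) by rewrite wset.
by move=> /psi_invE[].
Qed.

Lemma is_dirder_what eta :
  is_dirder (Omega B G D) zhat (B z) eta (what B G D z (eta, 0)).
Proof.
move=> t eta_ t0 eta_cvg Ok; rewrite zhatz.
by have [] := zhat_first_order t0 eta_cvg Ok.
Qed.

Lemma tangent2_image w v : tangent2 (Gamma G D) z w v ->
  tangent2 (Omega B G D) (B z) ('d B z w) ('d B z v + hess2 B z w).
Proof.
move=> [t [v_ [t0 v_cvg Gv]]].
have u_cvg : (fun k => w + (2^-1 * t k) *: v_ k) @ \oo --> w by exact: cvg_second_order_step v_cvg.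
pose xi_ k := (2^-1 * t k ^+ 2)^-1 *:
  (B (z + t k *: w + (2^-1 * t k ^+ 2) *: v_ k) - B z - t k *: 'd B z w).
exists t, xi_; split=> // [|k].
  have := cvgD (differential_cvg (F := B) (z := z) v_cvg)
    (second_order_quotient (z := z) B_C2 t0 u_cvg).
  move=> /(_ _); apply: near_cvg; apply: nearW => k.
  by rewrite fctE addrC subrK.
exists (z + t k *: w + (2^-1 * t k ^+ 2) *: v_ k); first exact: Gv.
have s0 : 2^-1 * t k ^+ 2 != 0 by rewrite gt_eqF// mulr_gt0 ?invr_gt0// exprn_gt0// t0.1.
rewrite /xi_ [in RHS]scalerA divff// scale1r -[RHS]addrA.
by rewrite [X in _ = _ + X]addrC subrK [RHS]addrC subrK.
Qed.

(** No bound on [v_] is available in advance. Reading the path as a first order one with directions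
    tending to [eta] gives [w + (t k / 2) *: v_ k --> w], which is what [second_order_quotient]
    needs; [v_] then solves a perturbed system. *)
Lemma zhat_second_order t (xi_ : nat -> 'rV[R]_m) (xi eta : 'rV[R]_m) :
  down_to_0 t -> xi_ @ \oo --> xi ->
  (forall k, Omega B G D (B z + t k *: eta + (2^-1 * t k ^+ 2) *: xi_ k)) ->
  let w := what B G D z (eta, 0) in
  let p := (xi - hess2 B z w, - hess2 G z w) in
  let v_ k := (2^-1 * t k ^+ 2)^-1 *:
    (zhat (B z + t k *: eta + (2^-1 * t k ^+ 2) *: xi_ k) - z - t k *: w) in
  [/\ \forall k \near \oo, Gamma G D (z + t k *: w + (2^-1 * t k ^+ 2) *: v_ k),
      v_ @ \oo --> what B G D z p &
      psi_inv B G D z p = [set what B G D z p]].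
Proof.
move=> t0 xi_cvg Ok w p v_.
have s0 k : 2^-1 * t k ^+ 2 != 0 by rewrite gt_eqF// mulr_gt0 ?invr_gt0// exprn_gt0// t0.1.
pose eta_ k := eta + (2^-1 * t k) *: xi_ k.
have eta_cvg : eta_ @ \oo --> eta by exact: cvg_second_order_step xi_cvg.
have Ok' k : Omega B G D (B z + t k *: eta_ k).
  by rewrite -second_order_pointE; exact: Ok.
have [loc w_cvg wset] := zhat_first_order t0 eta_cvg Ok'.
pose u k := w + (2^-1 * t k) *: v_ k.
(* The perturbed directions are exactly the first order quotients of [zhat]. *)
have uE k : u k = (t k)^-1 *: (zhat (B z + t k *: eta_ k) - z).
  have tk0 : t k != 0 by rewrite gt_eqF// t0.1.
  rewrite /u /v_ second_order_pointE -/(eta_ k) scalerA.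
  move: (zhat _) => y; apply/rowP => i; rewrite !mxE; field.
  by [].
have u_cvg : u @ \oo --> w by apply: near_cvg w_cvg; apply: nearW => k; rewrite uE.
have {}loc : \forall k \near \oo,
    B (z + t k *: u k) = B z + t k *: eta_ k /\ Gamma G D (z + t k *: u k).
  by apply: filterS loc => k; rewrite uE.
have locD : \forall k \near \oo, D (G (z + t k *: u k)) by apply: filterS loc => k [].
(* The first equation cancels the terms [t k *: eta]; the second lets [t k *: 'd G z w] be
   subtracted without leaving the subspace. *)
have [dBw dGw] : 'd B z w = eta /\ splus (tangent D (G z)) ('d G z w).
  have : psi_inv B G D z (eta, 0) w by rewrite wset.
  by move=> /psi_invE; rewrite subr0.
pose c p (F : 'rV[R]_n -> 'rV[R]_p) k := (2^-1 * t k ^+ 2)^-1 *: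
  (F (z + t k *: w + (2^-1 * t k ^+ 2) *: v_ k) - F z - t k *: 'd F z w) - 'd F z (v_ k).
have cB : (fun k => xi_ k - c _ B k) @ \oo --> xi - hess2 B z w.
  exact: (cvgB xi_cvg (second_order_quotient B_C2 t0 u_cvg)).
have cG : (fun k => - c _ G k) @ \oo --> - hess2 G z w.
  exact: (cvgN (second_order_quotient G_C2 t0 u_cvg)).
have u_b : bounded_near u \oo by exact: cvg_bounded u_cvg.
have sol : \forall k \near \oo, psi_inv B G D z (xi_ k - c _ B k, - c _ G k) (v_ k).
  apply: filterS2 loc (near_difference_splus t0 u_b locD) => k [Bk _] Sk.
  apply/psi_invE; split.
    have BkE : B z + t k *: eta_ k - B z - t k *: eta = (2^-1 * t k ^+ 2) *: xi_ k.
      by apply/rowP => i; rewrite /eta_ !mxE; ring.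
    rewrite /c second_order_pointE -/(u k) Bk dBw BkE scalerA mulVf//.
    by rewrite scale1r subKr.
  rewrite opprK /c addrC subrK second_order_pointE.
  exact: splus_linear_combination.
have [vcvg vset] := cvg_psi_inv inj cB cG sol.
by split=> //; apply: filterS loc => k []; rewrite second_order_pointE.
Qed.

End LocalInverse.

(** * Passage from the neighborhoods and bounds to the local setting, and the tangent set
    formulas *)

Unset Implicit Arguments.

Theorem theorem3p5 (R : realType) (n m l : nat)
  (B : 'rV[R]_n -> 'rV[R]_m) (G : 'rV[R]_n -> 'rV[R]_l) (D : set 'rV[R]_l)
  (B_C2 : twice_continuously_differentiable B)
  (G_C2 : twice_continuously_differentiable G)
  (D_poly : polyhedral D)
  (omegabar : 'rV[R]_m) (omegabar_in : Omega B G D omegabar)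
  (zbar : 'rV[R]_n) (zbar_in : Sigma B G D omegabar zbar)
  (nondeg : forall w : 'rV[R]_n, 'd B zbar w = 0 -> Llin G D zbar w -> w = 0)
  (gammaB : R) (gammaB_gt0 : 0 < gammaB)
  (Wt : set 'rV[R]_n) (Wt_nbhs : open_nbhs zbar Wt)
  (gammaB_min :
     (gammaB%:E < ereal_inf [set (enorm ('d B zbar w))%:E |
        w in [set w | Llin G D zbar w /\ enorm w = 1%R]])%E)
  (gammaB_L : forall z, (Gamma G D `&` Wt) z ->
     forall w, Llin G D z w -> gammaB * enorm w <= enorm ('d B z w))
  (gammaB_B : forall z1 z2, (Gamma G D `&` Wt) z1 -> (Gamma G D `&` Wt) z2 ->
     gammaB * enorm (z1 - z2) <= enorm (B z1 - B z2))
  (O : set 'rV[R]_m) (O_nbhs : open_nbhs omegabar O)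
  (W : set 'rV[R]_n) (W_nbhs : open_nbhs zbar W) (W_sub : W `<=` Wt)
  (zhat : 'rV[R]_m -> 'rV[R]_n)
  (zhat_bij : set_bij (Omega B G D `&` O) (Gamma G D `&` W) zhat)
  (zhat_lip : forall omega1 omega2,
     (Omega B G D `&` O) omega1 -> (Omega B G D `&` O) omega2 ->
     enorm (zhat omega1 - zhat omega2) <= gammaB^-1 * enorm (omega1 - omega2))
  (zhat_inv : forall omega, (Omega B G D `&` O) omega ->
     (B @^-1` [set omega] `&` Gamma G D) `&` W = [set zhat omega]) :
  forall omega, (Omega B G D `&` O) omega ->
  let z := zhat omega in
  (* (i) *)
  (tangent (Omega B G D) omega = [set 'd B z w | w in tangent (Gamma G D) z] /\
   forall eta, tangent (Omega B G D) omega eta ->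
     [/\ is_dirder (Omega B G D) zhat omega eta
           (dirder (Omega B G D) zhat omega eta),
         psi_inv B G D z (eta, 0) = [set what B G D z (eta, 0)],
         dirder (Omega B G D) zhat omega eta = what B G D z (eta, 0) &
         tangent (Gamma G D) z (what B G D z (eta, 0))]) /\
  (* (ii) *)
  (forall eta, tangent (Omega B G D) omega eta ->
   let w := dirder (Omega B G D) zhat omega eta in
   tangent2 (Omega B G D) omega eta =
     [set 'd B z v + hess2 B z w | v in tangent2 (Gamma G D) z w] /\
   forall xi, tangent2 (Omega B G D) omega eta xi ->
     let p := (xi - hess2 B z w, - hess2 G z w) in
     [/\ is_dirder2 (Omega B G D) zhat omega eta xi
           (dirder2 (Omega B G D) zhat omega eta xi),
         psi_inv B G D z p = [set what B G D z p],
         dirder2 (Omega B G D) zhat omega eta xi = what B G D z p &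
         tangent2 (Gamma G D) z w (what B G D z p)]).
Proof.
move=> omega Oomega z.
have [[Bz Dz] Wz] : ((B @^-1` [set omega] `&` Gamma G D) `&` W) z by rewrite zhat_inv.
have zhatz : zhat (B z) = z by rewrite Bz.
(* The Lipschitz bound is Euclidean; [Num.sqrt m%:R] is the cost of bounding the Euclidean norm on
   the right by the sup norm. *)
pose M := gammaB^-1 * Num.sqrt m%:R.
have zhat_loc : \forall o \near B z, Omega B G D o ->
    [/\ B (zhat o) = o, D (G (zhat o)) & `|zhat o - z| <= M * `|o - B z|].
  have [Oopen _] := O_nbhs.
  have : nbhs (B z) O by apply: open_nbhs_nbhs; split=> //; rewrite Bz; exact: Oomega.2.
  apply: filterS => o Oo Omo.
  have [[Bo Do] _] : ((B @^-1` [set o] `&` Gamma G D) `&` W) (zhat o).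
    by rewrite zhat_inv.
  split=> //; apply: (le_trans (norm_le_enorm _)).
  apply: (le_trans (zhat_lip _ _ (conj Omo Oo) Oomega)); rewrite Bz /M -mulrA.
  by rewrite ler_wpM2l ?invr_ge0 ?(ltW gammaB_gt0)//; exact: enorm_le_norm.
(* The bound [gammaB_L] applies at [z] because [W] lies in [Wt]. *)
have inj w : Llin G D z w -> 'd B z w = 0 -> w = 0.
  move=> Lw Bw; have := gammaB_L z (conj Dz (W_sub _ Wz)) w Lw.
  rewrite Bw enorm0 pmulr_rle0// => w0.
  by apply/eqP; rewrite -normr_le0; exact: le_trans (norm_le_enorm w) w0.
(* From here [z] is any point with the local properties just established, and [B z] replaces
   [omega]. *)
rewrite -Bz; clearbody z; clear omega Oomega Bz.
have first := what_tangent B_C2 G_C2 D_poly Dz inj zhat_loc.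
have dir eta := is_dirder_what B_C2 G_C2 D_poly Dz inj zhatz zhat_loc (eta := eta).
split; first split.
- apply/seteqP; split=> [eta /first[_ Tw Bw]|_ [w Tw <-]].
    by exists (what B G D z (eta, 0)).
  exact: tangent_image.
- move=> eta Teta; have [wset Tw _] := first _ Teta.
  by have [-> ?] := dirder_unique Teta (dir eta); split.
move=> eta Teta; have [-> _] := dirder_unique Teta (dir eta).
have [wset Tw Bw] := first _ Teta; set w := what B G D z (eta, 0) in Tw Bw *.
split.
  apply/seteqP; split=> [xi [t [xi_ [t0 xi_cvg Ok]]]|_ [v Tv <-]]; last first.
    by rewrite -[X in tangent2 _ _ X]Bw; exact: tangent2_image.
  have [loc v_cvg vset] := zhat_second_order B_C2 G_C2 D_poly Dz inj zhat_loc t0 xi_cvg Ok.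
  (* The limit of the second order quotients of [zhat] is the required [v]: the [B] component of its
     system reads ['d B z v = xi - hess2 B z w]. *)
  exists (what B G D z (xi - hess2 B z w, - hess2 G z w)).
    exact: near_tangent2 t0 v_cvg loc.
  have : psi_inv B G D z (xi - hess2 B z w, - hess2 G z w)
      (what B G D z (xi - hess2 B z w, - hess2 G z w)) by rewrite vset.
  by move=> /psi_invE[-> _]; rewrite subrK.
move=> xi Txi p.
have dir2 : is_dirder2 (Omega B G D) zhat (B z) eta xi (what B G D z p).
  (* [is_dirder2] is phrased with [dirder], which has to be identified with [w] first. *)
  move=> t xi_ t0 xi_cvg Ok; rewrite zhatz (dirder_unique Teta (dir eta)).1.
  by have [] := zhat_second_order B_C2 G_C2 D_poly Dz inj zhat_loc t0 xi_cvg Ok.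
have [-> ?] := dirder2_unique Txi dir2.
have [t [xi_ [t0 xi_cvg Ok]]] := Txi.
have [loc v_cvg vset] := zhat_second_order B_C2 G_C2 D_poly Dz inj zhat_loc t0 xi_cvg Ok.
by split=> //; exact: near_tangent2 t0 v_cvg loc.
Qed.
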